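(* Let $\mathbb{M}$ be a denumerable ultrametric space. The following properties are equivalent: (i) $\mathbb{M}$ is isometric to some $\mathbb{U}\mathrm{lt}_V$, where $V$ is dually well-ordered; (ii) $\mathbb{M}$ is point-homogeneous, $P:=(\mathrm{Nerv}(\mathbb{M}),\supseteq)$ is well-founded and the degree of every non-maximal element of $P$ is infinite; (iii) $\mathbb{M}$ is homogeneous and indivisible.
   Context: A metric space is ultrametric if $d(x,z)\leq\max\{d(x,y),d(y,z)\}$ for all $x,y,z$. The spectrum of $\mathbb{M}=(M,d)$ is $\{d(x,y): x,y\in M\}$; for $a\in M$, $Spec(\mathbb{M},a)=\{d(a,x): x\in M\}$. The age of a metric space is the class of all finite metric spaces that embed isometrically into it. A metric space is homogeneous if every isometry between two of its finite subspaces extends to an isometry of the space onto itself. It is point-homogeneous if its group of isometries (onto itself) acts transitively on its points. A metric space $\mathbb{M}=(M;d)$ is indivisible if for every partition of $M$ into two parts, at least one of the parts contains an isometric copy of $\mathbb{M}$. For a countable set $V$ with $0\in V\subseteq\mathbb{R}_+$ (the non-negative reals), $\mathbb{U}\mathrm{lt}_V$ is the Urysohn ultrametric space with spectrum $V$: the countable homogeneous ultrametric space (unique up to isometry) whose age is the class of all finite ultrametric spaces whose spectrum is included in $V$. A set $V$ of reals is dually well-ordered if every non-empty subset of $V$ has a largest element. For $a\in M$ and $s\in\mathbb{R}_+$, $\mathcal{B}_a(s):=\{x\in M: d(a,x)\leq s\}$. $\mathrm{Nerv}(\mathbb{M}):=\{\mathcal{B}_a(s): a\in M,\ s\in Spec(\mathbb{M},a)\}$,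 ordered by reverse inclusion $\supseteq$; for an ultrametric space, in this order $P$ any two elements have an infimum, denoted $x\wedge y$, and the maximal elements of $P$ are the singletons. $\max(P)$ denotes the set of maximal elements of $P$. For $x\in P$ non-maximal, the degree of $x$ is the maximum cardinality of a subset $X\subseteq\max(P)$ such that $x=a\wedge b$ for every pair of distinct elements $a,b$ of $X$ (such a maximum exists). A poset is well-founded if every non-empty subset has a minimal element. *)

(* Defs.v *)
From mathcomp Require Import all_boot all_order all_algebra.
From mathcomp Require Import all_classical all_reals all_analysis.

Set Implicit Arguments.
Unset Strict Implicit.
Unset Printing Implicit Defensive.

Import Order.TTheory GRing.Theory Num.Theory.
Local Open Scope classical_set_scope.
Local Open Scope card_scope.
Local Open Scope ring_scope.

Section Posets.
(* The poset has carrier the set P, ordered by the restriction of le to P. *)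
Context {T : Type} (P : set T) (le : T -> T -> Prop).

Definition minimal_elements (X : set T) : set T :=
  [set x | X x /\ forall y, X y -> le y x -> y = x].

Definition maximal_elements : set T :=
  [set x | P x /\ forall y, P y -> le x y -> y = x].

Definition well_founded_poset : Prop :=
  forall X : set T, X `<=` P -> X !=set0 -> minimal_elements X !=set0.

Definition is_inf (a b x : T) : Prop :=
  [/\ P x, le x a, le x b & forall y, P y -> le y a -> le y b -> le y x].

Definition degree_witness (x : T) (X : set T) : Prop :=
  X `<=` maximal_elements /\
  forall a b, X a -> X b -> a <> b -> is_inf a b x.

(* The degree of x is the cardinality of any X with [realizes_degree x X]. *)
Definition realizes_degree (x : T) (X : set T) : Prop :=
  degree_witness x X /\ forall Y, degree_witness x Y -> Y #<= X.

Definition infinite_degree (x : T) : Prop :=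
  exists X, realizes_degree x X /\ infinite_set X.

End Posets.

Section MetricSpaces.
Context {R : realType}.
Implicit Types M N : metricType R.

Definition ultrametric M : Prop :=
  forall x y z : M, mdist x z <= Num.max (mdist x y) (mdist y z).

Definition spectrum M : set R := [set r | exists x y : M, r = mdist x y].

Definition spectrum_at M (a : M) : set R := range (mdist a).

Definition isometric_embedding M N (f : M -> N) : Prop :=
  forall x y, mdist (f x) (f y) = mdist x y.

Definition embeds M N : Prop := exists f : M -> N, isometric_embedding f.

Definition onto_isometry M N (f : M -> N) : Prop :=
  isometric_embedding f /\ bijective f.

Definition isometric M N : Prop := exists f : M -> N, onto_isometry f.

(* An isometry between finite subspaces is given by its finite domain A and by
   a total function f of which only the restriction to A matters; its codomain
   is f @` A. *)
Definition homogeneous M : Prop :=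
  forall (A : set M) (f : M -> M), finite_set A ->
    (forall x y, A x -> A y -> mdist (f x) (f y) = mdist x y) ->
  exists g : M -> M, onto_isometry g /\ forall x, A x -> g x = f x.

Definition point_homogeneous M : Prop :=
  forall x y : M, exists g : M -> M, onto_isometry g /\ g x = y.

Definition contains_copy M (A : set M) : Prop :=
  exists f : M -> M, isometric_embedding f /\ range f `<=` A.

Definition indivisible M : Prop :=
  forall A B : set M, A `|` B = setT -> A `&` B = set0 ->
  contains_copy A \/ contains_copy B.

(* U is a copy of the Urysohn ultrametric space with spectrum V; the metric
   spaces F below stand for the members of the age. *)
Definition is_Ult (V : set R) (U : metricType R) : Prop :=
  [/\ countable [set: U], ultrametric U, homogeneous U &
      forall F : metricType R, finite_set [set: F] ->
        (embeds F U <-> ultrametric F /\ spectrum F `<=` V)].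

Definition dually_well_ordered (V : set R) : Prop :=
  forall W : set R, W `<=` V -> W !=set0 -> exists2 m, W m & ubound W m.

(* The balls of the nerve are closed, unlike those of the library's [ball]. *)
Definition metric_cball M (a : M) (s : R) : set M := [set x | mdist a x <= s].

Definition Nerv M : set (set M) :=
  [set B | exists a s, spectrum_at a s /\ B = metric_cball a s].

End MetricSpaces.

Arguments Nerv {R} M _.

Definition rev_incl {T : Type} (B C : set T) : Prop := C `<=` B.

(* Main.v *)
Require Import Defs.
From HB Require Import structures.
From mathcomp Require Import all_boot all_order all_algebra.
From mathcomp Require Import all_classical all_reals all_analysis.

Set Implicit Arguments.
Unset Strict Implicit.
Unset Printing Implicit Defensive.

Import Order.TTheory GRing.Theory Num.Theory.
Local Open Scope classical_set_scope.
Local Open Scope ring_scope.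

(** The three conditions meet in one local property. Call M branching if, for
    every point a, every nonzero distance s of M and every finite set S, some b
    at distance exactly s from a has distance at least s to all of S: the closed
    ball of radius s around a splits into infinitely many classes of the
    relation d(x, y) < s. Each of the three conditions says, for the
    countable ultrametric space M, that M is branching and that its spectrum is
    dually well-ordered.

    Where branching comes from: a point-homogeneous ultrametric space is
    branching as soon as it has finite equidistant sets of every size for each
    distance s ([large_equidistant_branching], a pigeonhole argument). The age
    of the Urysohn space provides such sets, and so do infinite degrees in the
    nerve, since the infimum of two singletons {p} and {q} is the ball of
    radius d(p, q) around p. Indivisibility provides them through a colouring
    that isolates one class in each ball of radius s
    ([indivisible_large_equidistant]).

    What branching gives: in an ultrametric space a one-point extension of a
    finite partial isometry is determined by a nearest point of the domain and
    its distance, so branching is exactly what allows all extensions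
    ([branching_extension]). Going forth gives embeddings, hence the age; going
    back and forth gives homogeneity.

    Dual well-ordering of the spectrum is well-foundedness of the nerve, whose
    balls around one point are indexed by their radii. It follows from
    indivisibility by a colouring by parity along a strictly increasing
    sequence of distances ([indivisible_dually_well_ordered]).

    Finally, a branching space with dually well-ordered spectrum is indivisible
    ([branching_dichotomy]). Given a part A, call a ball rich if A has
    inside it a nonempty subset that branches at all distances up to the radius
    of the ball. If the points of a set Q that branches at all distances up to t
    are all centres of rich balls, then gluing pieces taken in the largest rich
    balls gives a subset of A that branches at all distances up to t
    ([rich_glue]). So either A contains a copy of M, or the set of the points
    all of whose balls are not rich is nonempty, branching and disjoint from A,
    because a point of A is itself a rich ball of radius 0. *)

(** * Finite sequences *)

Section Sequences.

Lemma seq_argmin (T : eqType) d (U : orderType d) (f : T -> U) (l : seq T) :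
  l != [::] -> exists2 p, p \in l & forall q, q \in l -> (f p <= f q)%O.
Proof.
elim: l => // a l IH _; have [->|/IH [p pl pmin]] := eqVneq l [::].
  by exists a; rewrite ?mem_head// => q; rewrite inE => /eqP->.
have [fap|fpa] := leP (f a) (f p).
  exists a; rewrite ?mem_head// => q; rewrite inE => /predU1P[->//|/pmin].
  exact: le_trans.
exists p; first by rewrite inE pl orbT.
by move=> q; rewrite inE => /predU1P[->|/pmin//]; exact: ltW.
Qed.

(** The predicates D n are tasks, met one after the other; everything built by
    forth or by back-and-forth below is the union of such a chain. *)
Lemma increasing_chain (T : eqType) (P : seq T -> Prop)
    (D : nat -> seq T -> Prop) (l0 : seq T) :
  P l0 ->
  (forall n l, P l -> exists l', [/\ {subset l <= l'}, P l' & D n l']) ->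
  exists u : nat -> seq T, [/\ u 0%N = l0, forall n, P (u n),
    forall n m, (n <= m)%N -> {subset u n <= u m} & forall n, D n (u n.+1)].
Proof.
move=> Pl0 ext.
have /choice[e eP] : forall nl : nat * seq T, exists l', P nl.2 ->
    [/\ {subset nl.2 <= l'}, P l' & D nl.1 l'].
  move=> [n l]; have [Pl|nPl] := pselect (P l); last by exists l.
  by have [l' l'P] := ext n l Pl; exists l'.
pose u n := iteri n (fun n l => e (n, l)) l0.
have uP n : P (u n).
  by elim: n => // n IH; have [] := eP (n, u n) IH.
exists u; split=> // [n m /subnK<-|n]; last by have [] := eP (n, u n) (uP n).
elim: (m - n)%N => // k IH x /IH xk.
by have [+ _ _] := eP ((k + n)%N, u (k + n)%N) (uP _); exact.
Qed.

End Sequences.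

(** * Ultrametric distances *)

Section Ultrametric.
Context {R : realType}.

Section Triangles.
Context {M : metricType R}.
Hypothesis M_ultra : ultrametric M.
Implicit Types x y z : M.

Lemma ultra_le s x y z : mdist x y <= s -> mdist y z <= s -> mdist x z <= s.
Proof. by move=> xy yz; rewrite (le_trans (M_ultra x y z))// ge_max xy. Qed.

Lemma ultra_lt s x y z : mdist x y < s -> mdist y z < s -> mdist x z < s.
Proof. by move=> xy yz; rewrite (le_lt_trans (M_ultra x y z))// gt_max xy. Qed.

Lemma ultra_ge s x y z : mdist x y < s -> s <= mdist x z -> s <= mdist y z.
Proof.
by move=> xy; apply: contra_le => yz; exact: ultra_lt yz.
Qed.

Lemma ultra_isosceles x y z : mdist x y < mdist y z -> mdist x z = mdist y z.
Proof.
move=> xy; apply/eqP; rewrite eq_le (ultra_le (ltW xy))//=.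
by apply: (@ultra_ge _ y) => //; rewrite metric_sym.
Qed.

End Triangles.

Lemma isometric_embedding_inj (M N : metricType R) (f : M -> N) :
  isometric_embedding f -> injective f.
Proof.
move=> fiso x y fxy; apply: mdist_positivity.
by rewrite -fiso fxy mdistxx.
Qed.

Lemma spectrum_ge0 (M : metricType R) s : spectrum M s -> 0 <= s.
Proof. by move=> [x [y ->]]; exact: mdist_ge0. Qed.

(** * Branching sets and extension of isometries *)

(** Equivalently, for every a in A and nonzero s in V, the set A meets
    infinitely many classes of d(x, y) < s inside the closed ball of radius s
    around a. *)
Definition branching (M : metricType R) (V : set R) (A : set M) : Prop :=
  forall a s (S : seq M), A a -> V s -> 0 < s ->
  exists b, [/\ A b, mdist a b = s & forall x, x \in S -> s <= mdist b x].

Section Extension.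
Context {F N : metricType R}.
Hypotheses (F_ultra : ultrametric F) (N_ultra : ultrametric N).

Definition partial_isometry (l : seq (F * N)) : Prop :=
  forall p q, p \in l -> q \in l -> mdist p.2 q.2 = mdist p.1 q.1.

(** If p is a pair of l whose first component is nearest to x, say at distance
    s, then y has to be at distance s from p.2 and at distance at least s from
    every other second component. These conditions suffice: a point of the
    domain farther than s from p.1 sees x and p.1 at the same distance, and the
    others are at distance exactly s from x. *)
Lemma branching_extension (A : set N) (l : seq (F * N)) (x : F) :
  branching (spectrum F) A -> A !=set0 -> partial_isometry l ->
  (forall p, p \in l -> A p.2) ->
  exists2 y, A y & partial_isometry ((x, y) :: l).
Proof.
move=> Abr A0 lP lA.
suff [y Ay yP] : exists2 y, A y &
    forall p, p \in l -> mdist y p.2 = mdist x p.1.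
  exists y => // p q; rewrite !inE => /predU1P[->|pl] /predU1P[->|ql] /=.
  - by rewrite !mdistxx.
  - exact: yP.
  - by rewrite metric_sym yP// metric_sym.
  - exact: lP.
have [l0|/(seq_argmin (fun p => mdist x p.1)) [p pl pmin]] := eqVneq l [::].
  by have [y Ay] := A0; exists y => // p; rewrite l0.
have [xp|xp] := eqVneq x p.1.
  by exists p.2; [exact: lA|move=> q ql; rewrite xp lP].
have s0 : 0 < mdist x p.1 by rewrite mdist_gt0.
have Vs : spectrum F (mdist x p.1) by exists x, p.1.
have [b [Ab pb bS]] := Abr _ _ [seq q.2 | q <- l] (lA _ pl) Vs s0.
exists b => // q ql; have pq := lP _ _ pl ql.
have [lt|le] := ltP (mdist x p.1) (mdist p.1 q.1).
  rewrite (ultra_isosceles F_ultra lt) -pq.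
  by rewrite (@ultra_isosceles _ N_ultra b p.2)// metric_sym pb pq.
have -> : mdist x q.1 = mdist x p.1.
  by apply/eqP; rewrite eq_le (ultra_le F_ultra (lexx _) le) pmin.
apply/eqP; rewrite eq_le bS ?map_f// andbT.
by apply: (@ultra_le _ N_ultra _ _ p.2); [rewrite metric_sym pb|rewrite pq].
Qed.

Lemma chain_isometry (u : nat -> seq (F * N)) :
  (forall n, partial_isometry (u n)) ->
  (forall n m, (n <= m)%N -> {subset u n <= u m}) ->
  (forall x, exists n, x \in [seq p.1 | p <- u n]) ->
  exists f : F -> N, isometric_embedding f /\
    forall n p, p \in u n -> f p.1 = p.2.
Proof.
move=> uP umono utot.
have /choice[f fP] : forall x, exists y, exists n, (x, y) \in u n.
  by move=> x; have [n /mapP[[x' y] pu ->]] := utot x; exists y, n.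
have common m n p q : p \in u m -> q \in u n ->
    mdist p.2 q.2 = mdist p.1 q.1.
  move=> pm qn; apply: (uP (maxn m n)).
    by apply: umono pm; rewrite leq_maxl.
  by apply: umono qn; rewrite leq_maxr.
exists f; split=> [x y|n p pu].
  by have [[m xm] [n yn]] := (fP x, fP y); exact: (common _ _ _ _ xm yn).
have [m xm] := fP p.1; apply: mdist_positivity.
by rewrite (common _ _ _ _ xm pu) mdistxx.
Qed.

End Extension.

Lemma branching_embedding (F N : metricType R) (A : set N) :
  ultrametric F -> ultrametric N -> countable [set: F] ->
  branching (spectrum F) A -> A !=set0 ->
  exists2 f : F -> N, isometric_embedding f & range f `<=` A.
Proof.
move=> Fu Nu /countable_injP[c c_inj] Abr A0.
have {}c_inj : injective c by move=> x y; apply: c_inj; rewrite inE.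
pose P (l : seq (F * N)) := partial_isometry l /\ forall p, p \in l -> A p.2.
pose D n (l : seq (F * N)) := forall x, c x = n -> x \in [seq p.1 | p <- l].
have ext n l : P l -> exists l', [/\ {subset l <= l'}, P l' & D n l'].
  move=> [lP lA]; have [[x xn]|nx] := pselect (exists x, c x = n); last first.
    by exists l; split=> // x xn; case: nx; exists x.
  have [y Ay yP] := branching_extension Fu Nu x Abr A0 lP lA.
  exists ((x, y) :: l); split.
  - by move=> p pl; rewrite inE pl orbT.
  - by split=> // p; rewrite inE => /predU1P[->//|/lA].
  - by move=> z; rewrite -xn => /c_inj ->; rewrite mem_head.
have [|u [_ uP umono uD]] := @increasing_chain _ P D [::] _ ext.
  by split=> [p|p].
have [| | |f [fiso fP]] := @chain_isometry F N u.
- by move=> n; have [] := uP n.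
- exact: umono.
- by move=> x; exists (c x).+1; exact: uD.
exists f => // _ [x _ <-]; have /mapP[p pu ->] := uD (c x) x erefl.
by rewrite (fP _ _ pu); have [_] := uP (c x).+1; exact.
Qed.

Lemma branching_homogeneous (M : metricType R) :
  ultrametric M -> countable [set: M] ->
  branching (spectrum M) [set: M] -> homogeneous M.
Proof.
move=> Mu /countable_injP[c c_inj] Mbr A f /finite_seqP[s ->] fP.
have {}c_inj : injective c by move=> x y; apply: c_inj; rewrite inE.
pose D n (l : seq (M * M)) := forall x, c x = n ->
  x \in [seq p.1 | p <- l] /\ x \in [seq p.2 | p <- l].
pose swap (l : seq (M * M)) := [seq (p.2, p.1) | p <- l].
have swapP l : partial_isometry l -> partial_isometry (swap l).
  by move=> lP _ _ /mapP[p pl ->] /mapP[q ql ->]; rewrite /= lP.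
have ext n l : partial_isometry l ->
    exists l', [/\ {subset l <= l'}, partial_isometry l' & D n l'].
  move=> lP; have [[x xn]|nx] := pselect (exists x, c x = n); last first.
    by exists l; split=> // x xn; case: nx; exists x.
  have M0 : [set: M] !=set0 by exists x.
  have [y _ yP] := branching_extension Mu Mu x Mbr M0 lP (fun _ _ => I).
  have [z _ zP] := branching_extension Mu Mu x Mbr M0 (swapP _ yP)
    (fun _ _ => I).
  exists ((z, x) :: (x, y) :: l); split.
  - by move=> p pl; rewrite !inE pl !orbT.
  - have := swapP _ zP; rewrite /swap /= -map_comp.
    by rewrite map_id_in// => -[].
  - by move=> w; rewrite -xn => /c_inj ->; rewrite !inE /= !eqxx !orbT.
have [|u [u0 uP umono uD]] :=
    @increasing_chain _ _ D [seq (x, f x) | x <- s] _ ext.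
  by move=> _ _ /mapP[x xs ->] /mapP[y ys ->]; rewrite /= fP.
have [x|g [giso gP]] := chain_isometry uP umono.
  by exists (c x).+1; have [] := uD (c x) x erefl.
exists g; split; last first.
  by move=> x /= xs; apply: (gP 0%N (x, f x)); rewrite u0; apply/mapP; exists x.
split=> //.
have /choice[h hP] : forall y, exists x, g x = y.
  move=> y; have [_ /mapP[p pu ->]] := uD (c y) y erefl.
  by exists p.1; rewrite (gP _ _ pu).
by exists h => // x; apply: (isometric_embedding_inj giso); rewrite hP.
Qed.


(** * Equidistant sets *)

Definition equidistant (M : metricType R) (s : R) (X : set M) : Prop :=
  forall x y, X x -> X y -> x <> y -> mdist x y = s.

Definition large_equidistant (M : metricType R) (s : R) : Prop :=
  forall n, exists l : seq M,
    [/\ size l = n, uniq l & equidistant s [set` l]].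

(** Move an equidistant set of size |S| + 2 so that it contains a. If all its
    points but a fail to be the required b, each is at distance less than s
    from some point of S or equal to a. Two of them cannot share a witness in
    a :: S, as their distance would be less than s; so they are at most
    |S| + 1. *)
Lemma large_equidistant_branching (M : metricType R) (V : set R) :
  ultrametric M -> point_homogeneous M ->
  (forall s, V s -> 0 < s -> large_equidistant M s) ->
  branching V [set: M].
Proof.
move=> Mu Mph Vl a s S _ Vs s0; apply: contrapT => nb.
have [[|x0 l] [size_l uniq_l l_eq]] := Vl s Vs s0 (size S).+2 => //.
have [g [[giso _] gx0]] := Mph x0 a.
have /choice[h hP] : forall y, exists x, y \in x0 :: l ->
    x \in a :: S /\ mdist (g y) x < s.
  move=> y; have [yl|yl] := boolP (y \in x0 :: l); last by exists a.
  have [->|yx0] := eqVneq y x0.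
    by exists a => _; rewrite mem_head gx0 mdistxx.
  apply: contrapT => ny; apply: nb; exists (g y); split=> // [|x xS].
    rewrite -gx0 giso; apply: l_eq => //=; first by rewrite mem_head.
    by apply/eqP; rewrite eq_sym.
  rewrite leNgt; apply/negP => xy; apply: ny; exists x => _.
  by rewrite inE xS orbT.
have h_uniq : uniq [seq h y | y <- x0 :: l].
  rewrite map_inj_in_uniq// => y z /[dup] yl /hP[_ hy] /[dup] zl /hP[_ hz] hyz.
  apply: contrapT => yz; have := l_eq _ _ yl zl yz; rewrite -giso => gyz.
  suff : s < s by rewrite ltxx.
  by rewrite -[X in X < _]gyz (ultra_lt Mu hy)// hyz metric_sym.
have : (size (x0 :: l) <= size (a :: S))%N.
  rewrite -(size_map h); apply: uniq_leq_size => // _ /mapP[y yl ->].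
  by have [] := hP y yl.
by rewrite size_l /= ltnn.
Qed.

Section EquidistantSpace.
Context (T : choiceType) (s : R) (s_gt0 : 0 < s).

(** The argument [s_gt0] is kept in the type, since the metric structure
    attached to it needs the positivity of s. *)
Definition equidistant_space : Type := let _ := s_gt0 in T.

HB.instance Definition _ := Choice.on equidistant_space.

Definition equidistant_dist (x y : equidistant_space) : R :=
  if x == y then 0 else s.

Let dxx x : equidistant_dist x x = 0.
Proof. by rewrite /equidistant_dist eqxx. Qed.

Let d_eq0 x y : equidistant_dist x y = 0 -> x = y.
Proof.
rewrite /equidistant_dist; case: eqP => // _ s0.
by move: s_gt0; rewrite s0 ltxx.
Qed.

Let d_sym x y : equidistant_dist x y = equidistant_dist y x.
Proof. by rewrite /equidistant_dist eq_sym. Qed.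

Let d_ultra x y z : equidistant_dist x z <=
  Num.max (equidistant_dist x y) (equidistant_dist y z).
Proof.
rewrite /equidistant_dist le_max; case: (eqVneq x z) => [_|xz].
  by case: eqP => _; rewrite ?lexx ?(ltW s_gt0).
case: (eqVneq x y) => [<-|_]; last by rewrite lexx.
by rewrite (negbTE xz) lexx orbT.
Qed.

Let d_triangle y x z :
  equidistant_dist x z <= equidistant_dist x y + equidistant_dist y z.
Proof.
have d_ge0 u v : 0 <= equidistant_dist u v.
  by rewrite /equidistant_dist; case: ifP => // _; exact: ltW.
apply: (le_trans (d_ultra x y z)).
by rewrite ge_max lerDl lerDr !d_ge0.
Qed.

HB.instance Definition _ :=
  isMetric.Build R equidistant_space dxx d_eq0 d_sym d_triangle.

Lemma equidistant_space_ultrametric : ultrametric equidistant_space.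
Proof. exact: d_ultra. Qed.

Lemma equidistant_space_spectrum (V : set R) :
  V 0 -> V s -> spectrum equidistant_space `<=` V.
Proof.
move=> V0 Vs _ [x [y ->]]; rewrite /mdist/= /equidistant_dist.
by case: ifP.
Qed.

Lemma equidistant_space_dist (x y : equidistant_space) :
  x != y -> mdist x y = s.
Proof. by rewrite /mdist/= /equidistant_dist => /negbTE ->. Qed.

End EquidistantSpace.

(** * Consequences of indivisibility *)

Section Indivisible.
Context (M : metricType R).
Hypotheses (M_ultra : ultrametric M) (M_indiv : indivisible M).

Lemma indivisible_setC (A : set M) : contains_copy A \/ contains_copy (~` A).
Proof. by apply: M_indiv; rewrite ?setUv ?setICr. Qed.

(** Fix one centre in each closed ball of radius s, and colour a point by
    whether it is at distance less than s from its centre. A copy of M has two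
    points at distance s, so it is not contained in the first colour. In a copy
    contained in the second, the image of an equidistant set is extended by
    the centre of the ball that contains it: the size of equidistant sets is
    not bounded. *)
Lemma indivisible_large_equidistant s :
  spectrum M s -> 0 < s -> large_equidistant M s.
Proof.
move=> [p [p' sE]] s0; elim=> [|n [[|x0 l] [size_l uniq_l l_eq]]].
- by exists [::]; split=> // x y.
- exists [:: p]; rewrite -size_l; split=> // x y /=.
  by rewrite !inE => /eqP -> /eqP ->.
(* The default p does not depend on q, so that c is constant on balls. *)
pose c q : M := xget p [set x | mdist q x <= s].
have cP q : mdist q (c q) <= s.
  apply: (@xgetPex _ p [set x | mdist q x <= s]).
  by exists q; rewrite /= mdistxx ltW.
have c_eq q q' : mdist q q' <= s -> c q = c q'.
  move=> qq'; congr xget; apply/seteqP; split=> x /= xq.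
    by apply: (ultra_le M_ultra _ xq); rewrite metric_sym.
  exact: (ultra_le M_ultra qq').
have [[f [fiso fA]]|[f [fiso fA]]] :=
    indivisible_setC [set q | mdist q (c q) < s].
  have fp : mdist (f p) (c (f p)) < s by apply: fA; exists p.
  have fp' : mdist (f p') (c (f p')) < s by apply: fA; exists p'.
  have : mdist (f p) (f p') < s.
    apply: (ultra_lt M_ultra fp); rewrite metric_sym.
    by rewrite (@c_eq _ (f p'))// fiso sE.
  by rewrite fiso -sE ltxx.
have fc x : mdist (f x) (c (f x)) = s.
  apply/eqP; rewrite eq_le cP/= leNgt; apply/negP.
  by have := fA (f x); apply; exists x.
have c_const x : x \in x0 :: l -> c (f x) = c (f x0).
  move=> xl; apply: c_eq; rewrite fiso.
  have [->|/eqP xx0] := eqVneq x x0; first by rewrite mdistxx ltW.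
  by rewrite (l_eq _ _ xl (mem_head _ _) xx0).
have c_dist x : x \in x0 :: l -> mdist (f x) (c (f x0)) = s.
  by move=> xl; rewrite -(c_const x xl) fc.
exists (c (f x0) :: [seq f x | x <- x0 :: l]); split.
- by rewrite -size_l /= size_map.
- rewrite cons_uniq map_inj_uniq ?uniq_l ?andbT; last first.
    exact: isometric_embedding_inj.
  apply/mapP => -[x /c_dist xl cE]; move: s0.
  by rewrite -xl cE mdistxx ltxx.
- have mem_new z : [set` c (f x0) :: [seq f x | x <- x0 :: l]] z ->
      z = c (f x0) \/ exists2 x, x \in x0 :: l & z = f x.
    by rewrite /mkset in_cons => /predU1P[->|/mapP]; [left|right].
  move=> x y /mem_new[->|[x' xl ->]] /mem_new[->|[y' yl ->]] // xy.
  + by rewrite metric_sym c_dist.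
  + by rewrite c_dist.
  + by rewrite fiso; apply: l_eq => // x'y'; apply: xy; rewrite x'y'.
Qed.

(** Otherwise the spectrum has a strictly increasing sequence s. Being at
    distance less than some s n is an equivalence relation; fix a centre in
    each class, and put in the first part the points whose distance to their
    centre is some s n with n even. If m is large, some point of a given copy
    is at distance s m from its centre, so a copy meets both parts. *)
Lemma indivisible_dually_well_ordered :
  point_homogeneous M -> dually_well_ordered (spectrum M).
Proof.
move=> Mph W WV [w0 Ww0]; apply: contrapT => nomax.
have next w : exists w', W w -> W w' /\ w < w'.
  have [Ww|Ww] := pselect (W w); last by exists w.
  apply: contrapT => nw; apply: nomax; exists w => // v Wv.
  by rewrite leNgt; apply/negP => wv; apply: nw; exists v.
have /choice[nx nxP] := next.
pose s n := iter n nx w0.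
have sW n : W (s n) by elim: n => // n IH; have [] := nxP _ IH.
have s_mono : {homo s : m n / (m < n)%N >-> m < n}.
  by apply: homo_ltn lt_trans _ => n; have [] := nxP _ (sW n).
have s_le m n : (m <= n)%N -> s m <= s n.
  by rewrite leq_eqVlt => /predU1P[->//|/s_mono /ltW].
have [p _] := WV _ Ww0.
pose c x : M := xget p [set y | exists n, mdist x y < s n].
have cP x : exists n, mdist x (c x) < s n.
  apply: (@xgetPex _ p [set y | exists n, mdist x y < s n]).
  exists x, 1%N; rewrite mdistxx (le_lt_trans _ (s_mono 0%N 1%N isT))//.
  exact/spectrum_ge0/WV/sW.
have c_eq x y n : mdist x y < s n -> c x = c y.
  move=> xy; congr xget; apply/seteqP; split=> z /= [m zm]; exists (maxn n m).
    apply: (@ultra_lt _ M_ultra _ _ x).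
      rewrite metric_sym (lt_le_trans xy)//.
      by rewrite s_le ?leq_maxl.
    by rewrite (lt_le_trans zm)// s_le ?leq_maxr.
  apply: (@ultra_lt _ M_ultra _ _ y).
    by rewrite (lt_le_trans xy)// s_le ?leq_maxl.
  by rewrite (lt_le_trans zm)// s_le ?leq_maxr.
(* Once s m exceeds the distance from f p to its centre, a point of the copy at
   distance s m from f p has the same centre and is at distance s m from it. *)
have sphere (f : M -> M) : isometric_embedding f ->
    exists n, forall m, (n <= m)%N -> exists y, mdist (f y) (c (f y)) = s m.
  move=> fiso; have [n pn] := cP (f p); exists n => m nm.
  have [a [b smE]] := WV _ (sW m).
  have [g [[giso _] gp]] := Mph a p.
  have pgb : mdist (f p) (f (g b)) = s m by rewrite fiso -gp giso.
  exists (g b); rewrite -(@c_eq (f p) _ m.+1); last by rewrite pgb s_mono.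
  have pm : mdist (c (f p)) (f p) < mdist (f p) (f (g b)).
    rewrite pgb metric_sym (lt_le_trans pn)//.
    by rewrite s_le.
  by rewrite metric_sym (ultra_isosceles M_ultra pm).
have s_inj m n : s m = s n -> m = n.
  by move=> smn; case: (ltngtP m n) => // /s_mono; rewrite smn ltxx.
have [[f [fiso fA]]|[f [fiso fA]]] := indivisible_setC
    [set x | exists n, mdist x (c x) = s n.*2].
- have [n /(_ n.*2.+1)[|y yn]] := sphere f fiso.
    by rewrite -addnn -addnS leq_addr.
  have [m] : exists m, mdist (f y) (c (f y)) = s m.*2 by apply: fA; exists y.
  by rewrite yn => /s_inj /(congr1 odd); rewrite /= !odd_double.
- have [n /(_ n.*2)[|y yn]] := sphere f fiso; first by rewrite -addnn leq_addr.
  have /= := fA (f y) (ex_intro2 _ _ y I erefl).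
  by case; exists n.
Qed.

End Indivisible.

(** * Branching spaces with dually well-ordered spectrum *)

Section BranchingIndivisible.
Context (M : metricType R).
Hypotheses (M_ultra : ultrametric M)
  (M_dwo : dually_well_ordered (spectrum M))
  (M_br : branching (spectrum M) [set: M]).

Definition spectrum_upto (t : R) : set R := [set s | spectrum M s /\ s <= t].

Definition rich_in_ball (A : set M) (p : M) (t : R) : Prop :=
  exists W : set M, [/\ W `<=` A `&` metric_cball p t, W !=set0 &
                        branching (spectrum_upto t) W].

(** In an ultrametric space every point of a ball is a centre of it. *)
Lemma rich_in_ball_center A p q t :
  mdist p q <= t -> rich_in_ball A p t -> rich_in_ball A q t.
Proof.
move=> pq [W [WA W0 Wbr]]; exists W; split=> // x /WA[Ax px]; split=> //.
by apply: (ultra_le M_ultra _ px); rewrite metric_sym.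
Qed.

(** Around each q in Q take the largest rich ball; it exists since the spectrum
    is dually well-ordered. W collects the branching pieces found in these
    balls. Let a be in a piece of radius r around q, and s at most t. If
    s <= r, the piece itself branches at a. If r < s, then Q branches at q
    towards some q' at distance s from it and at least s from S, and the
    largest rich ball around q' has a radius less than s: a rich ball around q'
    of radius at least s would contain q, against the maximality of r. So its
    piece lies within distance less than s of q', hence at distance s from a
    and at least s from S. *)
Lemma rich_glue (A Q : set M) t :
  Q !=set0 -> branching (spectrum_upto t) Q ->
  (forall q, Q q -> exists2 r, spectrum M r & rich_in_ball A q r) ->
  exists W : set M, [/\ W `<=` A, W !=set0, branching (spectrum_upto t) W &
    forall x, W x -> exists q r, [/\ Q q, spectrum M r, rich_in_ball A q r &
                                     mdist q x <= r]].
Proof.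
move=> [q0 Qq0] Qbr Qrich.
pose max_rich q r := [/\ spectrum M r, rich_in_ball A q r &
  forall r', spectrum M r' -> rich_in_ball A q r' -> r' <= r].
have max_exists q : Q q -> exists r, max_rich q r.
  move=> /Qrich[r Vr qr].
  have [||m [Vm qm] mub] := M_dwo
    (W := [set r | spectrum M r /\ rich_in_ball A q r]); first by move=> ? [].
  - by exists r.
  - by exists m; split=> // r' Vr' qr'; exact: mub.
pose piece q r U := [/\ Q q, max_rich q r,
  U `<=` A `&` metric_cball q r & branching (spectrum_upto r) U].
have piece_exists q : Q q -> exists r U, piece q r U /\ U !=set0.
  move=> Qq; have [r qr] := max_exists q Qq.
  by have [_ [U [UA U0 Ubr]] _] := qr; exists r, U; split.
exists [set x | exists q r U, piece q r U /\ U x]; split.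
- by move=> x [q [r [U [[_ _ UA _] /UA[]]]]].
- have [r [U [qrU [x Ux]]]] := piece_exists q0 Qq0.
  by exists x, q0, r, U.
- move=> a s S [q [r [U [qrU Ua]]]] [Vs st] s0.
  have [Qq [Vr qr r_max] UA Ubr] := qrU.
  have [sr|rs] := leP s r.
    have [b [Ub ab bS]] := Ubr a s S Ua (conj Vs sr) s0.
    by exists b; split=> //; exists q, r, U.
  have [q' [Qq' qq' q'S]] := Qbr q s S Qq (conj Vs st) s0.
  have [r' [U' [q'rU [b Ub]]]] := piece_exists q' Qq'.
  have [_ [Vr' q'r' _] UA' _] := q'rU.
  have r's : r' < s.
    rewrite ltNge; apply/negP => sr'.
    have : r' <= r.
      apply: r_max => //; apply: rich_in_ball_center q'r'.
      by rewrite metric_sym qq'.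
    by move=> r'r; move: (lt_le_trans rs (le_trans sr' r'r)); rewrite ltxx.
  have q'b : mdist q' b < s by have [_ /=/le_lt_trans] := UA' _ Ub; exact.
  have aq : mdist a q < s.
    by have [_] := UA _ Ua; rewrite metric_sym => /le_lt_trans; exact.
  have bq : mdist q b = s.
    rewrite metric_sym -qq' [RHS]metric_sym.
    apply: (ultra_isosceles M_ultra).
    by rewrite metric_sym [ltRHS]metric_sym qq'.
  exists b; split.
  + by exists q', r', U'.
  + by rewrite (@ultra_isosceles _ M_ultra a q) bq.
  + by move=> x /q'S; apply: (ultra_ge M_ultra).
- move=> x [q [r [U [[Qq [Vr qr _] UA _] /UA[_ /= qx]]]]].
  by exists q, r.
Qed.

(** A move by t < s changes no distance that is at least s, so it stays in Q; a
    move by s stays in Q if the new point also avoids p and S. *)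
Lemma branching_sphere (p : M) s (S : seq M) : spectrum M s -> 0 < s ->
  let Q := [set q | mdist p q = s /\ forall x, x \in S -> s <= mdist q x] in
  Q !=set0 /\ branching (spectrum_upto s) Q.
Proof.
move=> Vs s0 Q; split.
  by have [q [_ pq qS]] := @M_br p s S I Vs s0; exists q.
move=> q t T [pq qS] [Vt ts] t0; have [ts'|tlt] := eqVneq t s.
  have [b [_ qb bT]] := @M_br q t (p :: S ++ T) I Vt t0; exists b; split=> //.
    split; last first.
      by move=> x xS; rewrite -ts' bT// inE mem_cat xS orbT.
    apply/eqP; rewrite eq_le (@ultra_le _ M_ultra _ _ q) ?pq ?qb//=.
    by rewrite metric_sym -ts' bT// mem_head.
  by move=> x xT; rewrite bT// inE mem_cat xT !orbT.
have {tlt} {}ts : t < s by rewrite lt_neqAle tlt.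
have [b [_ qb bT]] := @M_br q t T I Vt t0; exists b; split=> //; split.
  rewrite metric_sym (@ultra_isosceles _ M_ultra b q)// metric_sym ?qb //.
  by rewrite [ltRHS]metric_sym pq.
by move=> x /qS; apply: (ultra_ge M_ultra); rewrite qb.
Qed.

(** W is found in A when every point of M is the centre of a rich ball, and
    otherwise W is the set of the poor points, which are the centres of no rich
    ball. The latter branches: at a poor point p, consider the set Q of the
    candidates for a new point at distance s. If none of them was poor, gluing
    over Q would make the ball of radius s around p rich. *)
Lemma branching_dichotomy (A : set M) : [set: M] !=set0 ->
  exists W : set M, [/\ W !=set0, branching (spectrum M) W &
                        W `<=` A \/ W `<=` ~` A].
Proof.
move=> [p0 _].
have V0 : spectrum M 0 by exists p0, p0; rewrite mdistxx.
have [m Vm mub] := M_dwo (@subset_refl _ _) (ex_intro _ _ V0).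
have upto_m W : branching (spectrum_upto m) W -> branching (spectrum M) W.
  by move=> Wbr a s S Wa Vs; apply: Wbr => //; split=> //; exact: mub.
pose poor p := forall r, spectrum M r -> ~ rich_in_ball A p r.
have notpoor p : ~ poor p -> exists2 r, spectrum M r & rich_in_ball A p r.
  move=> np; apply: contrapT => nr; apply: np => r Vr pr; apply: nr.
  by exists r.
have [[p1 poor_p1]|allrich] := pselect (exists p, poor p); last first.
  have [|||W [WA W0 Wbr _]] := @rich_glue A [set: M] m.
  - by exists p0.
  - by move=> a s S _ [Vs _]; exact: M_br.
  - by move=> q _; apply: notpoor => pq; apply: allrich; exists q.
  by exists W; split; [|exact: upto_m|left].
exists poor; split; first by exists p1.
- move=> p s S poor_p Vs s0; apply: contrapT => nq.
  have [Q0 Qbr] := branching_sphere p S Vs s0.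
  have [|W [WA W0 Wbr WQ]] := rich_glue (A := A) Q0 Qbr.
    move=> q [pq qS]; apply: notpoor => poor_q; apply: nq.
    by exists q.
  apply: (poor_p s Vs); exists W; split=> // x Wx; split; first exact: WA.
  have [q [r [[pq _] Vr qr qx]]] := WQ x Wx.
  have [sr|rs] := leP s r.
    case: (poor_p r Vr); apply: rich_in_ball_center qr.
    by rewrite metric_sym pq.
  by apply: (@ultra_le _ M_ultra _ _ q); rewrite ?pq// (le_trans qx)// ltW.
- right => p poor_p Ap; apply: (poor_p 0 V0); exists [set p]; split.
  + by move=> _ ->; split; rewrite /metric_cball/= ?mdistxx.
  + by exists p.
  + by move=> a s S _ [_ s_le0] s0; move: (lt_le_trans s0 s_le0); rewrite ltxx.
Qed.

End BranchingIndivisible.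

Lemma branching_indivisible (M : metricType R) :
  ultrametric M -> countable [set: M] -> [set: M] !=set0 ->
  dually_well_ordered (spectrum M) ->
  branching (spectrum M) [set: M] -> indivisible M.
Proof.
move=> Mu Mc M0 Mdwo Mbr A B AB AB0.
have [W [W0 Wbr WAB]] := branching_dichotomy Mu Mdwo Mbr A M0.
have [f fiso fW] := branching_embedding Mu Mu Mc Wbr W0.
case: WAB => WA; [left|right]; exists f; split=> // x /fW /WA //.
by have : [set: M] x by []; rewrite -AB => -[].
Qed.

(** * The nerve *)

Section Nerve.
Context (M : metricType R).
Hypothesis M_ultra : ultrametric M.
Implicit Types (a p q : M) (B : set M).

Local Notation le_nerve := (@rev_incl M).

Lemma metric_cball0 a : metric_cball a 0 = [set a].
Proof.
apply/seteqP; split=> [x /= ax|_ ->]; last by rewrite /metric_cball/= mdistxx.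
by apply/esym/mdist_positivity/eqP; rewrite eq_le ax mdist_ge0.
Qed.

Lemma Nerv_cball p q : Nerv M (metric_cball p (mdist p q)).
Proof. by exists p, (mdist p q); split=> //; exists q. Qed.

Lemma Nerv_point p : Nerv M [set p].
Proof. by rewrite -metric_cball0 -(mdistxx p); exact: Nerv_cball. Qed.

Lemma maximal_Nerv B :
  maximal_elements (Nerv M) le_nerve B <-> exists p, B = [set p].
Proof.
split=> [[[a [s [[c _ <-]] ->]] Bmax]|[p ->]].
  exists a; apply/esym/Bmax; first exact: Nerv_point.
  by move=> _ ->; rewrite /metric_cball/= mdistxx mdist_ge0.
split; first exact: Nerv_point.
move=> _ [a [s [[c _ <-]] ->]] sub; apply/seteqP; split=> // _ ->.
have : metric_cball a (mdist a c) a.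
  by rewrite /metric_cball/= mdistxx mdist_ge0.
by move=> /[dup] /sub <-.
Qed.

(** A ball that contains p and q contains the ball of radius d(p, q) around p,
    so the latter is their infimum; a ball of attained radius s around a is
    that one only if it contains p and d(p, q) = s. *)
Lemma is_inf_points a s p q : spectrum_at a s ->
  is_inf (Nerv M) le_nerve [set p] [set q] (metric_cball a s) <->
  mdist a p <= s /\ mdist p q = s.
Proof.
move=> [c _ acs]; split=> [[_ /(_ p erefl) ap /(_ q erefl) aq glb]|[ap pqs]].
  split=> //; apply/eqP; rewrite eq_le; apply/andP; split.
    by apply: (ultra_le M_ultra _ aq); rewrite metric_sym.
  have sub : metric_cball a s `<=` metric_cball p (mdist p q).
    apply: glb; first exact: Nerv_cball.
      by move=> _ ->; rewrite /metric_cball/= mdistxx mdist_ge0.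
    by move=> _ ->; rewrite /metric_cball/=.
  have pc : mdist p c <= mdist p q by apply: sub; rewrite /metric_cball/= acs.
  have pa : mdist p a <= mdist p q.
    by apply: sub; rewrite /metric_cball/= mdistxx -acs mdist_ge0.
  by rewrite -acs; apply: (ultra_le M_ultra _ pc); rewrite metric_sym.
split.
- by rewrite -acs; exact: Nerv_cball.
- by move=> _ ->.
- by move=> _ ->; apply: (ultra_le M_ultra ap); rewrite pqs.
- move=> _ [b [r [_ ->]]] /(_ p erefl) bp /(_ q erefl) bq x ax.
  have sr : s <= r.
    by rewrite -pqs; apply: (ultra_le M_ultra _ bq); rewrite metric_sym.
  rewrite /metric_cball/=; apply: (ultra_le M_ultra bp).
  apply: (@ultra_le _ M_ultra _ _ a); last exact: le_trans sr.
  by rewrite metric_sym (le_trans ap).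
Qed.

(** A ball of the largest possible radius in X is maximal for inclusion. *)
Lemma dually_well_ordered_well_founded :
  dually_well_ordered (spectrum M) -> well_founded_poset (Nerv M) le_nerve.
Proof.
move=> dwo X XN [_ /[dup] /XN [a0 [s0 [[c0 _ <-] ->]]] X0].
have [||m [a [Xa _]] mub] := dwo [set s | exists a, X (metric_cball a s) /\
    spectrum_at a s].
- by move=> s [a [_ [c _ <-]]]; exists a, c.
- by exists (mdist a0 c0), a0; split=> //; exists c0.
exists (metric_cball a m); split=> // _ /[dup] /XN [b [s [bs ->]]] Xb sub.
have sm : s <= m by apply: mub; exists b.
have ba : mdist b a <= s.
  apply: sub; rewrite /metric_cball/= mdistxx (le_trans _ sm)//.
  by case: bs => c _ <-; exact: mdist_ge0.
apply/seteqP; split=> // x bx; rewrite /metric_cball/=.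
apply: (@ultra_le _ M_ultra _ _ b); last exact: le_trans sm.
by rewrite metric_sym (le_trans ba).
Qed.

Lemma well_founded_dually_well_ordered : point_homogeneous M ->
  well_founded_poset (Nerv M) le_nerve -> dually_well_ordered (spectrum M).
Proof.
move=> Mph wf W WV [w0 Ww0]; have [a _] := WV _ Ww0.
have Wa w : W w -> spectrum_at a w.
  move=> /WV[x [y ->]]; have [g [[giso _] gx]] := Mph x a.
  by exists (g y) => //; rewrite -gx giso.
have [||_ [[m Wm <-] mmin]] := wf [set metric_cball a w | w in W].
- by move=> _ [w Ww <-]; exists a, w; split=> //; exact: Wa.
- by exists (metric_cball a w0), w0.
exists m => // w Ww; have [c _ ac] := Wa _ Ww.
rewrite leNgt; apply/negP => mw.
have mE : metric_cball a w = metric_cball a m.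
  by apply: mmin => [|x /= ax]; [exists w|exact: le_trans ax (ltW mw)].
have : metric_cball a w c by rewrite /metric_cball/= ac.
by rewrite mE /metric_cball/= ac leNgt mw.
Qed.

Lemma infinite_degree_large_equidistant : point_homogeneous M ->
  (forall x, Nerv M x -> ~ maximal_elements (Nerv M) le_nerve x ->
     infinite_degree (Nerv M) le_nerve x) ->
  forall s, spectrum M s -> 0 < s -> large_equidistant M s.
Proof.
move=> Mph deg _ [a [c ->]] s0 n.
have [|X [[[Xmax Xinf] _] X_infinite]] := deg _ (Nerv_cball a c).
  move/maximal_Nerv => [p pE].
  have : metric_cball a (mdist a c) a by rewrite /metric_cball/= mdistxx ltW.
  have : metric_cball a (mdist a c) c by rewrite /metric_cball/=.
  by rewrite pE => /= cp ap; move: s0; rewrite cp ap mdistxx ltxx.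
have Xpoint B : X B -> exists p, B = [set p] by move/Xmax/maximal_Nerv.
pose Y : set M := [set p | X [set p]].
have XE : X = [set [set p] | p in Y].
  apply/seteqP; split=> [B /[dup] /Xpoint [p ->]|_ [p Yp <-]] //.
  by exists p.
have Y_infinite : infinite_set Y.
  by move=> Yfin; apply: X_infinite; rewrite XE; exact: finite_image.
have [B BY nB] := infinite_set_fset n Y_infinite.
exists (take n (finmap.enum_fset B)); split.
- by rewrite size_take; move: nB; case: ltngtP.
- by rewrite take_uniq ?finmap.fset_uniq.
- move=> p q /mem_take /BY pX /mem_take /BY qX pq.
  have [] := (is_inf_points p q _).1 (Xinf _ _ pX qX _) => //.
  + by exists c.
  + by move=> pqE; apply: pq; have : [set q] p by rewrite -pqE.
Qed.

(** Any infinite witness realizes the degree, because the nerve has countably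
    many maximal elements; one is found by embedding the countable equidistant
    space. *)
Lemma branching_infinite_degree :
  countable [set: M] -> point_homogeneous M ->
  branching (spectrum M) [set: M] ->
  forall x, Nerv M x -> ~ maximal_elements (Nerv M) le_nerve x ->
    infinite_degree (Nerv M) le_nerve x.
Proof.
move=> Mc Mph Mbr _ [a [_ [[c _ <-] ->]]] nmax.
have s0 : 0 < mdist a c.
  rewrite lt_neqAle mdist_ge0 andbT; apply/eqP => s0; apply: nmax.
  by apply/maximal_Nerv; exists a; rewrite -s0 metric_cball0.
set s := mdist a c in s0 *.
pose F : metricType R := equidistant_space nat s0.
have Fsp : spectrum F `<=` spectrum M.
  apply: equidistant_space_spectrum; last by exists a, c.
  by exists a, a; rewrite mdistxx.
have [|||||f fiso _] := @branching_embedding F M [set: M].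
- exact: equidistant_space_ultrametric.
- exact: M_ultra.
- exact: (@countableP nat).
- by move=> b t S _ /Fsp; exact: Mbr.
- by exists a.
have [g [[giso _] ga]] := Mph (f (0%N : F)) a.
pose u n := g (f (n : F)).
have u_dist m n : m != n -> mdist (u m) (u n) = s.
  by move=> mn; rewrite /u giso fiso; exact: equidistant_space_dist.
have u_inj : injective u.
  move=> m n /(isometric_embedding_inj giso).
  exact: isometric_embedding_inj.
exists (range (fun n => [set u n])).
have X_inf : infinite_set (range (fun n => [set u n])).
  apply/infiniteP/pcard_leP/injfunPex => /=; exists (fun n => [set u n]).
    by move=> n _; exists n.
  move=> m n _ _ uE; apply: u_inj.
  by have : [set u n] (u m) by rewrite -uE.
split=> //; split; first split.
- by move=> _ [n _ <-]; apply/maximal_Nerv; exists (u n).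
- move=> _ _ [m _ <-] [n _ <-] mn; apply/is_inf_points; first by exists c.
  have {}mn : m != n by apply: contra_not_neq mn => ->.
  split; last exact: u_dist.
  rewrite -ga -/(u 0%N); have [->|m0] := eqVneq m 0%N.
    by rewrite mdistxx ltW.
  by rewrite u_dist// eq_sym.
- move=> Y [Ymax _].
  apply: (@card_le_trans _ _ _ [set: nat]); last exact/infiniteP.
  apply: (@sub_countable _ _ _ [set [set p] | p in [set: M]]).
    by apply: subset_card_le => B /Ymax /maximal_Nerv [p ->]; exists p.
  exact: sub_countable (card_image_le _ _) Mc.
Qed.

End Nerve.

(** * Urysohn spaces *)

Section Age.
Context (M U : metricType R) (V : set R).
Hypotheses (V0 : V 0) (U_Ult : is_Ult V U) (MU : isometric M U).

Lemma is_Ult_point_homogeneous : point_homogeneous M.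
Proof.
have [[_ _ Uhom _] [f [fiso [f' fK f'K]]]] := (U_Ult, MU).
have f'iso : isometric_embedding f' by move=> x y; rewrite -fiso !f'K.
move=> x y; have [||g [[giso [g' gK g'K]] gx]] := Uhom [set f x] (fun=> f y).
- exact: finite_set1.
- by move=> _ _ -> ->; rewrite !mdistxx.
exists (f' \o g \o f); split; last by rewrite /= gx.
split; first by move=> z t; rewrite /= f'iso giso fiso.
by exists (f' \o g' \o f) => z /=; rewrite f'K ?gK ?g'K fK.
Qed.

Lemma is_Ult_embeds (F : metricType R) : finite_set [set: F] ->
  embeds F M <-> ultrametric F /\ spectrum F `<=` V.
Proof.
have [[_ _ _ age] [f [fiso [f' fK f'K]]]] := (U_Ult, MU).
have f'iso : isometric_embedding f' by move=> x y; rewrite -fiso !f'K.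
move=> Ffin; rewrite -age//; split=> -[g giso].
  by exists (f \o g) => x y; rewrite /= fiso.
by exists (f' \o g) => x y; rewrite /= f'iso.
Qed.

Lemma is_Ult_spectrum : spectrum M `<=` V.
Proof.
move=> _ [x [y ->]]; have [->|xy] := eqVneq x y; first by rewrite mdistxx.
have [s sE s0] : exists2 s, mdist x y = s & 0 < s.
  by exists (mdist x y); rewrite ?mdist_gt0.
have [|_] := (@is_Ult_embeds (equidistant_space bool s0) finite_finset).1.
  exists (fun b : bool => if b then x else y) => b b'.
  have [->|bb'] := eqVneq b b'; first by rewrite !mdistxx.
  rewrite equidistant_space_dist//.
  by case: b b' bb' => -[] // _; rewrite // metric_sym.
rewrite sE.
pose pt (b : bool) : equidistant_space bool s0 := b.
apply; exists (pt true), (pt false).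
by rewrite equidistant_space_dist.
Qed.

Lemma is_Ult_large_equidistant s :
  spectrum M s -> 0 < s -> large_equidistant M s.
Proof.
move=> /is_Ult_spectrum Vs s0 n.
pose F : metricType R := equidistant_space 'I_n s0.
have [f fiso] : embeds F M.
  apply/is_Ult_embeds; first exact: finite_finset.
  split; [exact: equidistant_space_ultrametric|].
  exact: equidistant_space_spectrum.
exists [seq f i | i <- enum 'I_n]; split.
- by rewrite size_map size_enum_ord.
- by rewrite map_inj_uniq ?enum_uniq//; exact: isometric_embedding_inj.
- move=> _ _ /mapP[i _ ->] /mapP[j _ ->] fij.
  rewrite fiso; apply: equidistant_space_dist.
  by apply/eqP => ij; apply: fij; rewrite ij.
Qed.

End Age.

End Ultrametric.

(** * The equivalence *)

Theorem theorem2p12 (R : realType) (M : metricType R)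
    (M_countable : countable [set: M]) (M_nonempty : [set: M] !=set0)
    (M_ultrametric : ultrametric M) :
  [<->
    exists V : set R,
      [/\ countable V, V 0, V `<=` [set r | 0 <= r], dually_well_ordered V &
          exists U : metricType R, is_Ult V U /\ isometric M U];
    [/\ point_homogeneous M,
        well_founded_poset (Nerv M) rev_incl &
        forall x, Nerv M x -> ~ maximal_elements (Nerv M) rev_incl x ->
          infinite_degree (Nerv M) rev_incl x];
    homogeneous M /\ indivisible M].
Proof.
split; first last; first split.
- move=> [Mph wf deg].
  have Mdwo := well_founded_dually_well_ordered Mph wf.
  have Mbr := large_equidistant_branching M_ultrametric Mph
    (infinite_degree_large_equidistant M_ultrametric Mph deg).
  by split; [exact: branching_homogeneous|exact: branching_indivisible].
- move=> [Mhom Mind].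
  have Mph : point_homogeneous M.
    move=> x y; have [||g [giso gx]] := Mhom [set x] (fun=> y).
    + exact: finite_set1.
    + by move=> _ _ -> ->; rewrite !mdistxx.
    by exists g; split=> //; exact: gx.
  have Mbr := large_equidistant_branching M_ultrametric Mph
    (indivisible_large_equidistant M_ultrametric Mind).
  exists (spectrum M); split.
  + have -> : spectrum M = [set mdist z.1 z.2 | z in [set: M] `*` [set: M]].
      apply/seteqP; split=> [_ [x [y ->]]|_ [[x y] _ <-]]; last by exists x, y.
      by exists (x, y).
      apply: sub_countable (card_image_le _ _) _.
      exact: countableX.
  + by have [x _] := M_nonempty; exists x, x; rewrite mdistxx.
  + exact: spectrum_ge0.
  + exact: indivisible_dually_well_ordered.
  + exists M; split; last by exists id; split=> //; exists id.
    split=> // F Ffin; split=> [[f fiso]|[Fu FM]].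
      split=> [x y z|_ [x [y ->]]]; first by rewrite -!fiso.
      by exists (f x), (f y).
    have [|f fiso _] := @branching_embedding R F M [set: M] Fu M_ultrametric
        (finite_set_countable Ffin) _ M_nonempty; last by exists f.
    by move=> a s S _ /FM; exact: Mbr.
- move=> [V [_ V0 _ Vdwo [U [U_Ult MU]]]].
  have Mph := is_Ult_point_homogeneous U_Ult MU.
  have MV := is_Ult_spectrum V0 U_Ult MU.
  have Mbr := large_equidistant_branching M_ultrametric Mph
    (is_Ult_large_equidistant V0 U_Ult MU).
  split=> //; last exact: branching_infinite_degree.
  apply: dually_well_ordered_well_founded => // W /subset_trans/(_ MV).
  exact: Vdwo.
Qed.
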